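(* Let $K$ be a field and let $G$ be a quasi-$n$-partite graph that has a loop at each of its vertices. Then $G$ is Cohen-Macaulay over $K$, i.e. $T/I(G)$ is a Cohen-Macaulay ring, where $T$ is the polynomial ring over $K$ whose variables are the vertices of $G$ and $I(G)\subset T$ is the edge ideal of $G$.
   Context: Graphs are finite and may have loops: an edge is a pair $\{x,y\}$ of vertices, and a loop is an edge $\{x,x\}$. A graph $G$ with loops is quasi-$n$-partite if its vertex set is $V=V_1\cup V_2\cup\cdots\cup V_n$ with $V_i=\{x_{i1},\ldots,x_{im_i}\}$ for $i=1,\ldots,n$ (all the $x_{ij}$ distinct), every edge which is not a loop joins a vertex of $V_i$ with a vertex of $V_{i+1}$ for some $i$, and some vertices of $V$ have loops. The polynomial ring is $T=K[x_{11},\ldots,x_{1m_1},\ldots,x_{n1},\ldots,x_{nm_n}]$, the variables being identified with the vertices. The edge ideal $I(G)\subset T$ is the ideal generated by all products $xy$ with $\{x,y\}$ an edge of $G$; in particular a loop $\{x,x\}$ contributes the generator $x^2$. The graph $G$ is called Cohen-Macaulay over $K$ if $T/I(G)$ is Cohen-Macaulay. *)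

(* Defs.v *)
From HB Require Import structures.
From mathcomp Require Import all_boot all_order all_algebra.
From mathcomp Require Import generic_quotient ring_quotient.
From mathcomp Require Import boolp.
From mathcomp Require Import mpoly ring.

Set Implicit Arguments.
Unset Strict Implicit.
Unset Printing Implicit Defensive.

Import GRing.Theory.
Local Open Scope ring_scope.
Local Open Scope quotient_scope.

(* In the library, [idealr R] and [prime_idealr R] are the proper ideals and
   the prime ideals of [R], as boolean predicates.  In the classical setting of
   [boolp] these are all the proper (resp. prime) ideals. *)

Section Ideals.
Variable R : comNzRingType.

Definition ideal_gen (s : seq R) : {pred R} :=
  fun y => `[< exists c : 'I_(size s) -> R, y = \sum_i c i * s`_i >].

Lemma ideal_genP (s : seq R) (y : R) :
  reflect (exists c : 'I_(size s) -> R, y = \sum_i c i * s`_i)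
          (y \in ideal_gen s).
Proof. exact: asboolP. Qed.

Lemma ideal_gen0 (s : seq R) : 0 \in ideal_gen s.
Proof.
by apply/ideal_genP; exists (fun=> 0); rewrite big1 // => i _; rewrite mul0r.
Qed.

Lemma ideal_gen_lin (s : seq R) (a : R) :
  {in ideal_gen s &, forall u v, a * u + v \in ideal_gen s}.
Proof.
move=> u v /ideal_genP[c ->] /ideal_genP[d ->]; apply/ideal_genP.
exists (fun i => a * c i + d i).
rewrite mulr_sumr -big_split /=; apply: eq_bigr => i _.
by rewrite mulrDl mulrA.
Qed.

(* The unit ideal, which is not an [idealr], is generated by 1. *)
Definition noetherian : Prop :=
  forall I : idealr R, exists s : seq R, I =i ideal_gen s.

Definition maximal_ideal (M : idealr R) : Prop :=
  forall J : idealr R, {subset M <= J} -> M =i J.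

Definition local_at (M : idealr R) : Prop :=
  maximal_ideal M /\ forall J : idealr R, maximal_ideal J -> J =i M.

(* A strictly increasing chain P_0 < ... < P_d of prime ideals, of length d. *)
Definition prime_chain (d : nat) (P : 'I_d.+1 -> prime_idealr R) : Prop :=
  forall i j : 'I_d.+1, (i < j)%N ->
    {subset P i <= P j} /\ exists2 x, x \in P j & x \notin P i.

Definition krull_dim_is (d : nat) : Prop :=
  (exists P : 'I_d.+1 -> prime_idealr R, prime_chain P) /\
  (forall (k : nat) (P : 'I_k.+1 -> prime_idealr R),
     prime_chain P -> (k <= d)%N).

(* The condition on 1 says that R / (s) is nonzero. *)
Definition regular_seq (s : seq R) : Prop :=
  1 \notin ideal_gen s /\
  forall i, (i < size s)%N ->
    forall a, a * s`_i \in ideal_gen (take i s) -> a \in ideal_gen (take i s).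

Definition depth_is (M : idealr R) (d : nat) : Prop :=
  (exists s : seq R, [/\ regular_seq s, {subset s <= M} & size s = d]) /\
  (forall s : seq R, regular_seq s -> {subset s <= M} -> (size s <= d)%N).

Definition cohen_macaulay_local : Prop :=
  noetherian /\
  exists M : idealr R,
    local_at M /\ exists d : nat, krull_dim_is d /\ depth_is M d.

End Ideals.

Section Localization.
Variables (R : comNzRingType) (P : prime_idealr R).

(* Equivalence classes of pairs (a, s), read as fractions a / s, with s in the
   complement of P. *)
Definition denom : Type := {s : R | s \notin P}.

HB.instance Definition _ := Choice.on denom.

Implicit Types (x y z : R * denom) (s t : denom).

Lemma denom1_subproof : (1 : R) \notin P.
Proof. by rewrite idealr1. Qed.

Definition denom1 : denom := exist _ 1 denom1_subproof.

Lemma denomM_subproof s t : sval s * sval t \notin P.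
Proof. by rewrite prime_idealrM negb_or (valP s) (valP t). Qed.

Definition denomM s t : denom := exist _ (sval s * sval t) (denomM_subproof s t).

Definition loc_equiv x y : bool :=
  `[< exists u : denom,
        sval u * (x.1 * sval y.2) = sval u * (y.1 * sval x.2) >].

Lemma loc_equiv_is_equiv : equiv_class_of loc_equiv.
Proof.
split=> [x|x y|y x z].
- by apply/asboolP; exists denom1.
- by apply/asboolP/asboolP => -[u e]; exists u.
- move=> /asboolP[u e] /asboolP[v f]; apply/asboolP.
  exists (denomM (denomM u v) y.2) => /=.
  move: e f; move: (sval u) (sval v) (sval y.2) (sval x.2) (sval z.2).
  move: (x.1) (y.1) (z.1) => ax ay az pu pv sy sx sz e f.
  have -> : pu * pv * sy * (ax * sz) = pv * sz * (pu * (ax * sy)) by ring.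
  rewrite e.
  have -> : pv * sz * (pu * (ay * sx)) = pu * sx * (pv * (ay * sz)) by ring.
  by rewrite f; ring.
Qed.

Canonical loc_equiv_equiv := EquivRelPack loc_equiv_is_equiv.
Canonical loc_equiv_encModRel := defaultEncModRel loc_equiv.

Definition localization := {eq_quot loc_equiv}.

HB.instance Definition _ : EqQuotient _ loc_equiv localization :=
  EqQuotient.on localization.
HB.instance Definition _ := Choice.on localization.

Definition frac (a : R) (s : denom) : localization := \pi_localization (a, s).

Lemma frac_eqP (a b : R) (s t : denom) :
  frac a s = frac b t <->
  exists u : denom, sval u * (a * sval t) = sval u * (b * sval s).
Proof.
rewrite /frac; split=> [/eqP|h]; last by apply/eqP; rewrite piE; apply/asboolP.
by rewrite piE => /asboolP.
Qed.

Lemma fracP (x : localization) : exists a s, x = frac a s.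
Proof. by exists (repr x).1, (repr x).2; rewrite /frac -surjective_pairing reprK. Qed.

Definition loc_zero : localization := frac 0 denom1.
Definition loc_one : localization := frac 1 denom1.
Definition loc_opp (x : localization) : localization :=
  frac (- (repr x).1) (repr x).2.
Definition loc_add (x y : localization) : localization :=
  frac ((repr x).1 * sval (repr y).2 + (repr y).1 * sval (repr x).2)
       (denomM (repr x).2 (repr y).2).
Definition loc_mul (x y : localization) : localization :=
  frac ((repr x).1 * (repr y).1) (denomM (repr x).2 (repr y).2).

Lemma repr_frac (a : R) (s : denom) :
  exists u : denom, sval u * ((repr (frac a s)).1 * sval s)
                    = sval u * (a * sval (repr (frac a s)).2).
Proof. by apply/frac_eqP; rewrite /frac -surjective_pairing reprK. Qed.

Lemma loc_oppE (a : R) (s : denom) : loc_opp (frac a s) = frac (- a) s.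
Proof.
have [u e] := repr_frac a s; apply/frac_eqP; exists u.
by rewrite !mulNr !mulrN e.
Qed.

Lemma loc_addE (a b : R) (s t : denom) :
  loc_add (frac a s) (frac b t) = frac (a * sval t + b * sval s) (denomM s t).
Proof.
have [u e] := repr_frac a s; have [v f] := repr_frac b t.
rewrite /loc_add; apply/frac_eqP; exists (denomM u v) => /=.
move: (repr (frac a s)) (repr (frac b t)) e f => x y.
move: (sval u) (sval v) (sval s) (sval t) (sval x.2) (sval y.2) (x.1) (y.1).
move=> pu pv ps pt sx sy ax ay e f.
have -> : pu * pv * ((ax * sy + ay * sx) * (ps * pt)) =
  pv * sy * pt * (pu * (ax * ps)) + pu * sx * ps * (pv * (ay * pt)) by ring.
by rewrite e f; ring.
Qed.

Lemma loc_mulE (a b : R) (s t : denom) :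
  loc_mul (frac a s) (frac b t) = frac (a * b) (denomM s t).
Proof.
have [u e] := repr_frac a s; have [v f] := repr_frac b t.
rewrite /loc_mul; apply/frac_eqP; exists (denomM u v) => /=.
move: (repr (frac a s)) (repr (frac b t)) e f => x y.
move: (sval u) (sval v) (sval s) (sval t) (sval x.2) (sval y.2) (x.1) (y.1).
move=> pu pv ps pt sx sy ax ay e f.
have -> : pu * pv * (ax * ay * (ps * pt)) =
  (pu * (ax * ps)) * (pv * (ay * pt)) by ring.
by rewrite e f; ring.
Qed.

Lemma frac_eq (a b : R) (s t : denom) :
  a * sval t = b * sval s -> frac a s = frac b t.
Proof. by move=> e; apply/frac_eqP; exists denom1; rewrite e. Qed.

Lemma loc_addA : associative loc_add.
Proof.
move=> x y z; have [a [s ->]] := fracP x; have [b [t ->]] := fracP y.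
have [c [r ->]] := fracP z; rewrite !loc_addE; apply: frac_eq => /=; ring.
Qed.

Lemma loc_addC : commutative loc_add.
Proof.
move=> x y; have [a [s ->]] := fracP x; have [b [t ->]] := fracP y.
rewrite !loc_addE; apply: frac_eq => /=; ring.
Qed.

Lemma loc_add0 : left_id loc_zero loc_add.
Proof.
move=> x; have [a [s ->]] := fracP x.
rewrite loc_addE; apply: frac_eq => /=; ring.
Qed.

Lemma loc_addN : left_inverse loc_zero loc_opp loc_add.
Proof.
move=> x; have [a [s ->]] := fracP x.
rewrite loc_oppE loc_addE; apply: frac_eq => /=; ring.
Qed.

HB.instance Definition _ :=
  GRing.isZmodule.Build localization loc_addA loc_addC loc_add0 loc_addN.

Lemma loc_mulA : associative loc_mul.
Proof.
move=> x y z; have [a [s ->]] := fracP x; have [b [t ->]] := fracP y.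
have [c [r ->]] := fracP z; rewrite !loc_mulE; apply: frac_eq => /=; ring.
Qed.

Lemma loc_mulC : commutative loc_mul.
Proof.
move=> x y; have [a [s ->]] := fracP x; have [b [t ->]] := fracP y.
rewrite !loc_mulE; apply: frac_eq => /=; ring.
Qed.

Lemma loc_mul1 : left_id loc_one loc_mul.
Proof.
move=> x; have [a [s ->]] := fracP x.
rewrite loc_mulE; apply: frac_eq => /=; ring.
Qed.

Lemma loc_mulDl : left_distributive loc_mul loc_add.
Proof.
move=> x y z; have [a [s ->]] := fracP x; have [b [t ->]] := fracP y.
have [c [r ->]] := fracP z.
by rewrite loc_addE !loc_mulE loc_addE; apply: frac_eq => /=; ring.
Qed.

Lemma loc_one_neq0 : loc_one != loc_zero.
Proof.
apply/eqP => /frac_eqP[u]; rewrite /= !mulr1 mulr0 => u0.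
by have := valP u; rewrite /= u0 idealr0.
Qed.

HB.instance Definition _ := GRing.Zmodule_isComNzRing.Build localization
  loc_mulA loc_mulC loc_mul1 loc_mulDl loc_one_neq0.

End Localization.

(* Maximal ideals are prime, so P ranges over all the maximal ideals of R. *)
Definition cohen_macaulay (R : comNzRingType) : Prop :=
  noetherian R /\
  forall P : prime_idealr R, maximal_ideal P ->
    cohen_macaulay_local (localization P).

(* A finite graph with loops: the edge {x, y} is [edge G x y], and {x, x} is a
   loop at x. *)
Record loop_graph (V : finType) := LoopGraph {
  edge : rel V;
  edge_sym : forall x y, edge x y = edge y x
}.

(* [part x] is the index i such that x lies in V_i; consecutive classes are not
   taken cyclically. *)
Definition quasi_n_partite (n : nat) (V : finType) (G : loop_graph V) : Prop :=
  (exists part : V -> 'I_n,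
     forall x y : V, edge G x y -> x != y ->
       (part y = (part x).+1 :> nat) \/ (part x = (part y).+1 :> nat)) /\
  (exists x : V, edge G x x).

Section EdgeIdeal.
Variables (K : fieldType) (V : finType) (G : loop_graph V).

Definition vertex_var (x : V) : {mpoly K[#|V|]} := 'X_(enum_rank x).

Definition edge_generators : seq {mpoly K[#|V|]} :=
  [seq vertex_var e.1 * vertex_var e.2 | e <- enum {: V * V} & edge G e.1 e.2].

Definition edge_ideal : {pred {mpoly K[#|V|]}} := ideal_gen edge_generators.

Lemma edge_ideal_closed : idealr_closed edge_ideal.
Proof.
split; [exact: ideal_gen0 | | exact: ideal_gen_lin].
apply/negP => /ideal_genP[c] /(congr1 (meval (fun=> 0))).
rewrite meval1 rmorph_sum /= big1 => [/eqP|i _]; first by rewrite oner_eq0.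
have /mapP[e _ ->] : edge_generators`_i \in edge_generators by exact: mem_nth.
by rewrite !mevalM mevalXU mul0r mulr0.
Qed.

HB.instance Definition _ := isIdealr.Build _ edge_ideal edge_ideal_closed.

Definition edge_ring : comNzRingType := {ideal_quot edge_ideal}.

End EdgeIdeal.

Definition cohen_macaulay_graph
    (K : fieldType) (V : finType) (G : loop_graph V) : Prop :=
  cohen_macaulay (edge_ring K G).

(* Main.v *)
From HB Require Import structures.
From mathcomp Require Import all_boot all_order all_algebra.
From mathcomp Require Import generic_quotient ring_quotient boolp mpoly ring.
Require Import Defs.

(** Since every vertex [x] carries a loop, [x ^+ 2 = 0] in the edge ring
    [R = T / I(G)], and this makes [R] an Artinian local ring.

    On the one hand, a monomial in which some variable occurs twice vanishes in
    [R], so [R] is spanned over [K] by the finitely many squarefree monomials;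
    being a finite-dimensional [K]-algebra, it is Noetherian
    ([edge_ring_span], [noetherian_lin_span]).  On the other hand, every
    nonconstant monomial is nilpotent in [R], so every element of [R] is a
    scalar plus a nilpotent; an element of a prime ideal must have zero scalar
    part, as the prime contains the nilpotent part and no nonzero scalar.
    Hence the only prime ideal of [R] is its nilradical
    ([edge_ring_prime_nil]).

    A Noetherian ring whose primes consist of nilpotents is Cohen-Macaulay
    ([cohen_macaulay_nil]): in a localization [L] at a prime every element is
    nilpotent or invertible, so the nilradical of [L] is its only prime ideal.
    Then [L] has Krull dimension 0, and depth 0 because a nilpotent element of
    a nonzero ring is a zero divisor ([cohen_macaulay_local_nil]). *)

Set Implicit Arguments.
Unset Strict Implicit.
Unset Printing Implicit Defensive.

Import GRing.Theory.
Local Open Scope ring_scope.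
Local Open Scope quotient_scope.

(** * Finitely generated ideals *)

Section IdealGeneration.
Variable R : comNzRingType.
Implicit Types (s : seq R) (x y a : R).

Lemma ideal_no_unit (I : idealr R) x y : x \in I -> x * y = 1 -> False.
Proof. by move=> xI xy1; have := idealMr y xI; rewrite mulrC xy1 idealr1. Qed.

Lemma ideal_gen_sub (I : idealr R) s :
  {subset s <= I} -> {subset ideal_gen s <= I}.
Proof.
move=> sI x /ideal_genP[c ->]; apply: rpred_sum => i _.
by apply: idealMr; apply: sI; apply: mem_nth.
Qed.

Lemma ideal_gen_cons a v x s :
  x - a * v \in ideal_gen s -> x \in ideal_gen (v :: s).
Proof.
move=> /ideal_genP[c xE]; apply/ideal_genP.
exists (fun i => oapp c a (unlift ord0 i)).
rewrite big_ord_recl unlift_none /= -[LHS](subrK (a * v)) xE addrC.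
by congr (_ + _); apply: eq_bigr => i _; rewrite liftK.
Qed.

Lemma mem_ideal_gen s x : x \in s -> x \in ideal_gen s.
Proof.
elim: s => // y s IHs; rewrite inE => /predU1P[->|/IHs xs].
  by apply: (@ideal_gen_cons 1); rewrite mul1r subrr ideal_gen0.
by apply: (@ideal_gen_cons 0); rewrite mul0r subr0.
Qed.

Lemma ideal_gen_mul s a x : x \in ideal_gen s -> a * x \in ideal_gen s.
Proof. by move=> xs; rewrite -[_ * _]addr0 ideal_gen_lin // ideal_gen0. Qed.

Lemma ideal_gen_sum (J : finType) s (c u : J -> R) :
  (forall j, u j \in ideal_gen s) -> \sum_j c j * u j \in ideal_gen s.
Proof.
move=> us; apply: (big_ind (fun x => x \in ideal_gen s)) => [|x y xs ys|j _].
- exact: ideal_gen0.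
- by rewrite -[x]mul1r; apply: ideal_gen_lin.
exact: ideal_gen_mul.
Qed.

End IdealGeneration.

(** * The nilradical *)

Section Nilradical.
Variable R : comNzRingType.
Implicit Types x y : R.

Definition nilradical : {pred R} := fun x => `[< exists n, x ^+ n = 0 >].

Lemma nilradicalP x : reflect (exists n, x ^+ n = 0) (x \in nilradical).
Proof. exact: asboolP. Qed.

Lemma nilradical_closed : idealr_closed nilradical.
Proof.
split.
- by apply/nilradicalP; exists 1%N; rewrite expr1.
- by apply/nilradicalP => -[n /eqP]; rewrite expr1n oner_eq0.
move=> a x y /nilradicalP[m xm0] /nilradicalP[n yn0].
(* Each term of the binomial expansion contains [x ^+ m] or [y ^+ n]. *)
apply/nilradicalP; exists (m + n)%N; rewrite exprDn big1 // => i _.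
have [le_ni|lt_in] := leqP n i.
  by rewrite -(subnK le_ni) (exprD y) yn0 mulr0 mulr0 mul0rn.
have le_m : (m <= m + n - i)%N by rewrite -addnBA ?leq_addr // ltnW.
by rewrite exprMn -(subnK le_m) (exprD x) xm0 mulr0 mulr0 mul0r mul0rn.
Qed.

HB.instance Definition _ := isIdealr.Build R nilradical nilradical_closed.

Lemma nilradical_sub_prime (P : prime_idealr R) : {subset nilradical <= P}.
Proof.
move=> x /nilradicalP[n xn0].
have: x ^+ n \in P by rewrite xn0 idealr0.
elim: n {xn0} => [|n IHn]; first by rewrite expr0 idealr1.
by rewrite exprS prime_idealrM => /orP[].
Qed.

End Nilradical.

Arguments nilradical R : clear implicits.

(** * Noetherian rings of fractions *)

Section NoetherianFractions.
Variables (R S : comNzRingType) (f : {rmorphism R -> S}).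

Section Preimage.
Variable J : idealr S.

Definition preim_ideal : {pred R} := fun a => f a \in J.

Lemma mem_preim_ideal a : (a \in preim_ideal) = (f a \in J).
Proof. by []. Qed.

Lemma preim_ideal_closed : idealr_closed preim_ideal.
Proof.
split=> [||a x y]; rewrite !mem_preim_ideal.
- by rewrite rmorph0 idealr0.
- by rewrite rmorph1 idealr1.
by move=> xJ yJ; rewrite rmorphD rmorphM rpredD // idealMr.
Qed.

HB.instance Definition _ := isIdealr.Build R preim_ideal preim_ideal_closed.

End Preimage.

Lemma ideal_gen_map (s : seq R) (a : R) :
  a \in ideal_gen s -> f a \in ideal_gen (map f s).
Proof.
move=> /ideal_genP[c ->]; rewrite rmorph_sum.
under eq_bigr do rewrite rmorphM.
by apply: ideal_gen_sum => i; rewrite mem_ideal_gen // map_f // mem_nth.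
Qed.

(** The hypothesis says that the elements of [S] are fractions [f a / u]. An
    ideal of [S] is then generated by the images of the generators of its
    preimage in [R]. *)
Lemma noetherian_fractions :
  (forall x, exists a u v, x * u = f a /\ u * v = 1) ->
  noetherian R -> noetherian S.
Proof.
move=> fracS noethR J.
have [s sE] := noethR (preim_ideal J); exists (map f s) => x; apply/idP/idP.
  move=> xJ; have [a [u [v [xu uv]]]] := fracS x.
  have: a \in ideal_gen s by rewrite -sE mem_preim_ideal -xu mulrC idealMr.
  move=> /ideal_gen_map/(ideal_gen_mul v).
  by rewrite -xu mulrCA (mulrC v) uv mulr1.
apply: ideal_gen_sub => _ /mapP[a a_s ->].
by rewrite -mem_preim_ideal sE mem_ideal_gen.
Qed.

End NoetherianFractions.

(** * Localization at a prime *)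

Section Localization.
Variables (R : comNzRingType) (P : prime_idealr R).

Lemma frac_mul (a b : R) (s t : denom P) :
  frac a s * frac b t = frac (a * b) (denomM s t).
Proof. exact: loc_mulE. Qed.

Lemma frac_sub (a b : R) (s t : denom P) :
  frac a s - frac b t = frac (a * sval t - b * sval s) (denomM s t).
Proof. by rewrite -mulNr -loc_addE -loc_oppE. Qed.

Definition to_loc (a : R) : localization P := frac a (denom1 P).

Lemma to_loc_zmod : zmod_morphism to_loc.
Proof.
by move=> a b; rewrite /to_loc frac_sub; apply: frac_eq => /=; ring.
Qed.

Lemma to_loc_monoid : monoid_morphism to_loc.
Proof. by split=> // a b; rewrite frac_mul; apply: frac_eq => /=; ring. Qed.

HB.instance Definition _ :=
  GRing.isZmodMorphism.Build R (localization P) to_loc to_loc_zmod.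
HB.instance Definition _ :=
  GRing.isMonoidMorphism.Build R (localization P) to_loc to_loc_monoid.

Lemma frac_unit (s t : denom P) : frac (sval s) t * frac (sval t) s = 1.
Proof. by rewrite frac_mul; apply: frac_eq => /=; ring. Qed.

Lemma noetherian_localization : noetherian R -> noetherian (localization P).
Proof.
apply: (@noetherian_fractions _ _ to_loc) => x.
have [a [s ->]] := fracP x; exists a, (to_loc (sval s)), (frac 1 s).
split; last exact: (frac_unit s (denom1 P)).
by rewrite frac_mul; apply: frac_eq => /=; ring.
Qed.

(** A fraction is nilpotent when its numerator lies in [P], and invertible
    otherwise. *)
Lemma localization_nil_or_unit :
  {subset P <= nilradical R} ->
  forall x : localization P,
    x \in nilradical (localization P) \/ exists y, x * y = 1.
Proof.
move=> Pnil x; have [a [s ->]] := fracP x.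
have [aP|aNP] := boolP (a \in P); last first.
  pose d : denom P := exist _ a aNP.
  by right; exists (frac (sval s) d); apply: (frac_unit d).
left; have /nilradicalP[n an0] := Pnil a aP.
have -> : frac a s = frac 1 s * to_loc a.
  by rewrite frac_mul; apply: frac_eq => /=; ring.
by apply: idealMr; apply/nilradicalP; exists n; rewrite -rmorphXn an0 rmorph0.
Qed.

End Localization.

(** * Cohen-Macaulay rings of dimension zero *)

Section NilpotentOrUnit.
Variable R : comNzRingType.
Hypothesis nil_or_unit :
  forall x : R, x \in nilradical R \/ exists y, x * y = 1.

Lemma ideal_sub_nilradical (I : idealr R) : {subset I <= nilradical R}.
Proof. by move=> x xI; have [//|[y /(ideal_no_unit xI)]] := nil_or_unit x. Qed.

Lemma nilradical_prime : prime_idealr_closed (nilradical R).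
Proof.
move=> x y xyN; have [-> //|[z xz1]] := nil_or_unit x; apply/orP; right.
by rewrite -[y]mul1r -xz1 -mulrA mulrCA; apply: idealMr.
Qed.

(** The nilradical is the largest proper ideal and the smallest prime, so it is
    the only prime: the dimension is 0.  The depth is 0 as well, since the first
    term of a nonempty regular sequence in the nilradical would be at once
    nilpotent and a nonzerodivisor. *)
Lemma cohen_macaulay_local_nil : noetherian R -> cohen_macaulay_local R.
Proof.
move=> noethR; split=> //; pose N : idealr R := nilradical R; exists N.
have maxN : maximal_ideal N.
  by move=> J NJ x; apply/idP/idP => [/NJ //|/ideal_sub_nilradical].
split; first split=> // J maxJ; first exact/maxJ/ideal_sub_nilradical.
exists 0%N; split; split.
- pose Np : prime_idealr R := HB.pack (nilradical R)
    (isPrimeIdealrClosed.Build R (nilradical R) nilradical_prime).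
  by exists (fun=> Np) => i j; rewrite !ord1.
- move=> k P chainP; rewrite leqNgt; apply/negP => k_gt0.
  have [_ [x xPk]] := chainP ord0 ord_max k_gt0.
  by rewrite (nilradical_sub_prime _ (ideal_sub_nilradical xPk)).
- exists [::]; split=> //; split=> //.
  by apply/ideal_genP => -[c /eqP]; rewrite big_ord0 oner_eq0.
move=> [//|x s] [_ /(_ 0%N isT) /= reg] xsN; exfalso.
have /nilradicalP[n xn0] : x \in nilradical R by apply: xsN; rewrite mem_head.
have gen0 y : y \in ideal_gen [::] -> y = 0.
  by case/ideal_genP=> c ->; rewrite big_ord0.
(* Cancelling the nonzerodivisor [x] repeatedly in [x ^+ n = 0] yields
   [1 = 0]. *)
elim: n xn0 => [/eqP|n IHn xn0]; first by rewrite oner_eq0.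
by apply/IHn/gen0/reg; rewrite -exprSr xn0 ideal_gen0.
Qed.

End NilpotentOrUnit.

Lemma cohen_macaulay_nil (R : comNzRingType) :
  noetherian R ->
  (forall P : prime_idealr R, {subset P <= nilradical R}) ->
  cohen_macaulay R.
Proof.
move=> noethR primeN; split=> // P _; apply: cohen_macaulay_local_nil.
  exact/localization_nil_or_unit/primeN.
exact: noetherian_localization.
Qed.

(** * Finite-dimensional algebras over a field *)

Section FiniteDimensional.
Variables (K : fieldType) (R : comNzRingType) (f : {rmorphism K -> R}).

(** Peeling off one coefficient at a time, rather than giving the family of all
    coefficients, lets proofs about [lin_span] go by induction on [s]. *)
Fixpoint lin_span (s : seq R) (x : R) : Prop :=
  if s is e :: s' then exists a, lin_span s' (x - f a * e) else x = 0.

Lemma lin_span_lin s a x y :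
  lin_span s x -> lin_span s y -> lin_span s (f a * x + y).
Proof.
elim: s x y => [|e s IHs] x y /=; first by move=> -> ->; rewrite mulr0 addr0.
move=> [b xs] [c ys]; exists (a * b + c).
rewrite rmorphD rmorphM (_ : _ - _ = f a * (x - f b * e) + (y - f c * e)).
  exact: IHs.
by ring.
Qed.

Lemma lin_span0 s : lin_span s 0.
Proof.
by elim: s => //= e s IHs; exists 0; rewrite rmorph0 mul0r subr0.
Qed.

Lemma mem_lin_span s x : x \in s -> lin_span s x.
Proof.
elim: s => //= e s IHs; rewrite inE => /predU1P[->|/IHs xs].
  by exists 1; rewrite rmorph1 mul1r subrr; apply: lin_span0.
by exists 0; rewrite rmorph0 mul0r subr0.
Qed.

(** Gaussian elimination on the spanning list [e :: s]: if some [v] in [W] has a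
    nonzero coefficient on [e], then subtracting multiples of [v] moves every
    element of [W] into the span of [s], where induction applies; otherwise [W]
    already lies in that span. The induction forces [W] to be a mere
    [K]-subspace, as the intersection of an ideal with the span of [s] need not
    be an ideal. *)
Lemma lin_subspace_fg (s : seq R) (W : R -> Prop) :
  (forall a x y, W x -> W y -> W (f a * x + y)) ->
  (forall x, W x -> lin_span s x) ->
  exists t : seq R, (forall x, x \in t -> W x) /\
    (forall x, W x -> x \in ideal_gen t).
Proof.
elim: s W => [|e s IHs] W linW Ws.
  by exists [::]; split=> // x /Ws ->; apply: ideal_gen0.
pose W' x := W x /\ lin_span s x.
have [|x [] //|t [tW' W't]] := IHs W'.
  by move=> a x y [? ?] [? ?]; split; [apply: linW | apply: lin_span_lin].
have [[v [a [Wv a_neq0 vs]]]|noW] :=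
    pselect (exists v a, [/\ W v, a != 0 & lin_span s (v - f a * e)]).
  exists (v :: t); split=> [x|x Wx].
    by rewrite inE => /predU1P[->|/tW'[]].
  have [b xs] := Ws x Wx; apply: (@ideal_gen_cons _ (f (b / a))); apply: W't.
  split; first by rewrite addrC -mulNr -rmorphN; apply: linW.
  rewrite (_ : _ - _ = f (- (b / a)) * (v - f a * e) + (x - f b * e)).
    exact: lin_span_lin.
  have fbE : f b = f (b / a) * f a by rewrite -rmorphM divfK.
  by rewrite rmorphN fbE; ring.
exists t; split=> [x /tW'[] //|x Wx]; apply: W't; split=> //.
have [b xs] := Ws x Wx; have [b0|b_neq0] := eqVneq b 0.
  by move: xs; rewrite b0 rmorph0 mul0r subr0.
by case: noW; exists x, b.
Qed.

Lemma noetherian_lin_span (s : seq R) :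
  (forall x, lin_span s x) -> noetherian R.
Proof.
move=> spanR I.
have [||t [tI It]] := @lin_subspace_fg s (fun x => x \in I) => //.
  by move=> a x y xI yI; rewrite rpredD // idealMr.
by exists t => x; apply/idP/idP => [/It|/(ideal_gen_sub tI)].
Qed.

End FiniteDimensional.

(** * The edge ring of a graph with all loops *)

Section LoopedEdgeRing.
Variables (K : fieldType) (V : finType) (G : loop_graph V).
Hypothesis loops : forall x, edge G x x.

Local Notation Q := {ideal_quot @edge_ideal K V G}.

(* The projection and the scalars are given the codomain [edge_ring K G], so
   that the morphism lemmas apply without unfolding the quotient. *)
Definition edge_pi (p : {mpoly K[#|V|]}) : edge_ring K G := \pi_Q p.
HB.instance Definition _ := GRing.RMorphism.copy edge_pi \pi_Q.

Definition edge_scalar (a : K) : edge_ring K G := edge_pi a%:MP.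
HB.instance Definition _ := GRing.RMorphism.copy edge_scalar
  (edge_pi \o @mpolyC #|V| K).

Lemma edge_pi_surj (x : edge_ring K G) : exists p, x = edge_pi p.
Proof. by exists (repr (x : Q)); rewrite /edge_pi reprK. Qed.

Lemma edge_pi_sqr0 (i : 'I_#|V|) : edge_pi 'X_i ^+ 2 = 0.
Proof.
rewrite -rmorphXn -[RHS](rmorph0 edge_pi); apply/eqP.
rewrite /edge_pi -Quotient.idealrBE subr0; apply: mem_ideal_gen.
apply/mapP; exists (enum_val i, enum_val i).
  by rewrite mem_filter /= loops mem_enum.
by rewrite /vertex_var /= enum_valK expr2.
Qed.

Lemma edge_pi_monomial0 (m : 'X_{1..#|V|}) (i : 'I_#|V|) :
  (1 < m i)%N -> edge_pi 'X_[m] = 0.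
Proof.
move=> m_gt1; rewrite mpolyXE_id rmorph_prod (bigD1 i) //= rmorphXn.
by rewrite -(subnK m_gt1) exprD edge_pi_sqr0 mulr0 mul0r.
Qed.

Lemma edge_pi_monomial_nil (m : 'X_{1..#|V|}) (i : 'I_#|V|) :
  (0 < m i)%N -> edge_pi 'X_[m] \in nilradical (edge_ring K G).
Proof.
move=> m_gt0; rewrite mpolyXE_id rmorph_prod (bigD1 i) //= rmorphXn.
rewrite mulrC -(subnK m_gt0) addn1 exprSr mulrA; apply: idealMr.
by apply/nilradicalP; exists 2; apply: edge_pi_sqr0.
Qed.

(** The functions [g] are the exponent vectors of the squarefree monomials; all
    other monomials vanish. *)
Lemma edge_ring_span (x : edge_ring K G) :
  lin_span edge_scalar
    [seq edge_pi 'X_[ [multinom (g i : nat) | i < #|V|] ]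
       | g : {ffun 'I_#|V| -> bool}] x.
Proof.
have [p ->] := edge_pi_surj x; set s := [seq _ | g : _].
rewrite [p]mpolyE rmorph_sum /=.
apply: (big_ind (lin_span edge_scalar s)) => [|u v us vs|m _].
- exact: lin_span0.
- by rewrite -[u]mul1r -(rmorph1 edge_scalar); apply: lin_span_lin.
rewrite -mul_mpolyC rmorphM -[_ * _]addr0; apply: lin_span_lin (lin_span0 _ _).
have [[i m_gt1]|sqfree] := pselect (exists i, (1 < m i)%N).
  by rewrite /= (edge_pi_monomial0 m_gt1); apply: lin_span0.
apply: mem_lin_span; apply/mapP; exists [ffun i => m i == 1%N].
  by rewrite mem_enum.
congr (edge_pi 'X_[_]); apply/mnmP => i; rewrite mnmE ffunE.
by case: (m i) (fun h => sqfree (ex_intro _ i h)) => [|[|k]] // /(_ isT).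
Qed.

(** The scalar is the constant term of any polynomial representing [x]. *)
Lemma edge_ring_scalar_mod_nil (x : edge_ring K G) :
  exists c, x - edge_scalar c \in nilradical (edge_ring K G).
Proof.
have [p ->] := edge_pi_surj x; rewrite [p]mpolyE rmorph_sum /=.
pose scalar_mod u := exists c, u - edge_scalar c \in nilradical (edge_ring K G).
apply: (big_ind scalar_mod) => [|u v [c uc] [d vd]|m _].
- by exists 0; rewrite rmorph0 subrr idealr0.
- by exists (c + d); rewrite rmorphD opprD addrACA rpredD.
rewrite -mul_mpolyC rmorphM.
have [[i m_gt0]|m0] := pselect (exists i, (0 < m i)%N).
  by exists 0; rewrite rmorph0 subr0 idealMr // (edge_pi_monomial_nil m_gt0).
exists p@_m; rewrite (_ : m = 0%MM) ?mpolyX0 ?rmorph1 ?mulr1 ?subrr ?idealr0 //.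
apply/mnmP => i; rewrite mnm0E; apply/eqP/contraT; rewrite -lt0n => mi_gt0.
by case: m0; exists i.
Qed.

Lemma edge_ring_prime_nil (P : prime_idealr (edge_ring K G)) :
  {subset P <= nilradical (edge_ring K G)}.
Proof.
move=> x xP; have [c xcN] := edge_ring_scalar_mod_nil x.
have cP : edge_scalar c \in P.
  by rewrite -[edge_scalar c](subKr x) rpredB // (nilradical_sub_prime P xcN).
have [c0|c_neq0] := eqVneq c 0; first by rewrite c0 rmorph0 subr0 in xcN.
case: (@ideal_no_unit _ P _ (edge_scalar c^-1) cP).
by rewrite -rmorphM divff // rmorph1.
Qed.

End LoopedEdgeRing.

Theorem theorem2p7 (K : fieldType) (n : nat) (V : finType) (G : loop_graph V) :
  quasi_n_partite n G ->
  (forall x : V, edge G x x) ->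
  cohen_macaulay_graph K G.
Proof.
move=> _ loops; apply: cohen_macaulay_nil.
  exact: noetherian_lin_span (edge_ring_span loops).
exact: edge_ring_prime_nil.
Qed.
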